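(* Let $G$ be a connected graph with root vertex $r$, and let $\phi$ be an atomic edge-coloring of $G$ that is a strong parity edge-coloring. For $x\in\mathbb{U}$ let $[x]=x+S_r$ denote its coset in the quotient space $\mathbb{U}/S_r$, and let $\pi(x)=[x]$. Then the edge-coloring $\phi^*$ assigning to each edge $uv$ the coset $[\phi(uv)]$ is a canonical edge-coloring of $G$ (with colors in the $\mathbb{F}_2$-vector space $\mathbb{U}/S_r$); moreover $\phi^*=\pi\circ\phi$, and $\phi^*$ uses no more colors than $\phi$.
   Context: $\mathbb{U}$ is the vector space over $\mathbb{F}_2$ of binary sequences with finitely many $1$s. An atom is a vector of $\mathbb{U}$ with exactly one coordinate equal to $1$; an atomic edge-coloring assigns an atom to each edge. For a walk $W$ with edges $e_1,\dots,e_t$ in order, $\phi(W)=\phi(e_1)+\cdots+\phi(e_t)$. For $v\in V(G)$, $S_v=\{\phi(W): W \text{ a walk from } r \text{ to } v\}$; when $\phi$ is a strong parity edge-coloring, $S_r$ is a linear subspace of $\mathbb{U}$. A walk is a parity walk if each color appears an even number of times along it (with multiplicity), and open if its endpoints are distinct; a strong parity edge-coloring is an edge-coloring with no open parity walk. A binary labeling of $G$ is an injective map $f\colon V(G)\to\mathbb{V}$ into an $\mathbb{F}_2$-vector space $\mathbb{V}$; a canonical edge-coloring is one of the form $uv\mapsto f(u)+f(v)$ for some binary labeling $f$. *)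

(* Defs.v *)
From HB Require Import structures.
From mathcomp Require Import all_boot all_algebra.
From mathcomp Require Import boolp.
From mathcomp Require Import monalg.

Set Implicit Arguments.
Unset Strict Implicit.
Unset Printing Implicit Defensive.

Import GRing.Theory.
Local Open Scope ring_scope.
Local Open Scope quotient_scope.

(* The space U: finitely supported functions from nat to 'F_2. *)
Definition binseq : Type := {malg 'F_2[nat]}.
HB.instance Definition _ := GRing.Lmodule.on binseq.

Definition coord (x : binseq) (i : nat) : 'F_2 := mcoeff i x.

Definition atom (x : binseq) : Prop :=
  exists2 i, coord x i = 1 & forall j, coord x j = 1 -> j = i.

Record sgraph := SGraph {
  vertex :> finType;
  adj : rel vertex;
  adj_sym : symmetric adj;
  adj_irr : irreflexive adj }.
Arguments adj {s} : rename.

Section Graphs.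
Variable G : sgraph.

Definition edges : {set {set G}} :=
  [set [set p.1; p.2] | p : G * G & adj p.1 p.2].

Definition connected_graph : Prop := forall u v : G, connect adj u v.

(* A walk is given by its first vertex u and the sequence p of the vertices
   that follow; its last vertex is last u p. *)
Definition walk (u : G) (p : seq G) : bool := path adj u p.

Definition walk_edges (u : G) (p : seq G) : seq {set G} :=
  pairmap (fun x y => [set x; y]) u p.

(* An edge-coloring is a function on {set G} of which only the values on
   edges G are ever used. *)
Section Coloring.
Variables (C : eqType) (phi : {set G} -> C).

Definition parity_walk (u : G) (p : seq G) : Prop :=
  forall c, ~~ odd (count_mem c [seq phi e | e <- walk_edges u p]).

Definition strong_parity : Prop :=
  ~ exists u p, [/\ walk u p, u != last u p & parity_walk u p].

Definition num_colors : nat := size (undup [seq phi e | e in edges]).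

End Coloring.

Definition canonical (V : lmodType 'F_2) (phi : {set G} -> V) : Prop :=
  exists2 f : G -> V, injective f &
    forall u v, adj u v -> phi [set u; v] = f u + f v.

Definition atomic (phi : {set G} -> binseq) : Prop :=
  {in edges, forall e, atom (phi e)}.

Definition walk_sum (phi : {set G} -> binseq) (u : G) (p : seq G) : binseq :=
  \sum_(e <- walk_edges u p) phi e.

(* The set S_v, for walks starting at the root r. *)
Definition walk_sums (phi : {set G} -> binseq) (r v : G) : {pred binseq} :=
  fun x => `[< exists p, [/\ walk r p, last r p = v & x = walk_sum phi r p] >].

Definition root_sums phi r : {pred binseq} := walk_sums phi r r.

End Graphs.

Lemma F2_cases (a : 'F_2) : a = 0 \/ a = 1.
Proof. by case: a => [[|[|//]] ?]; [left | right]; apply: val_inj. Qed.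

Lemma binseq_oppr (x : binseq) : - x = x.
Proof.
have e : (1 + 1 : 'F_2) = 0 by apply: val_inj.
by apply/eqP; rewrite eq_sym -addr_eq0 -{1 2}[x]scale1r -scalerDl e scale0r.
Qed.

Section QuotientSpace.
Variables (G : sgraph) (phi : {set G} -> binseq) (r : G).

Lemma root_sums_submod : submod_closed (root_sums phi r).
Proof.
have S0 : 0 \in root_sums phi r.
  by apply/asboolP; exists [::]; rewrite /walk_sum /= big_nil.
split=> // a x y Sx Sy; have [->|->] := F2_cases a.
  by rewrite scale0r add0r.
rewrite scale1r; move: Sx Sy => /asboolP[p [pp lp ->]] /asboolP[q [pq lq ->]].
apply/asboolP; exists (p ++ q); split.
- by rewrite /walk cat_path lp; apply/andP.
- by rewrite last_cat lp.
- by rewrite /walk_sum /walk_edges pairmap_cat big_cat lp.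
Qed.

HB.instance Definition _ :=
  GRing.isSubmodClosed.Build 'F_2 binseq (root_sums phi r) root_sums_submod.

Definition quot_space : Type := {ideal_quot (root_sums phi r)}.
HB.instance Definition _ := GRing.Zmodule.on quot_space.

(* The projection x |-> [x] = x + S_r; see coset_eqP. *)
Definition coset (x : binseq) : quot_space :=
  \pi_{ideal_quot (root_sums phi r)} x.

Lemma coset_eqP x y :
  coset x = coset y <-> exists2 s, s \in root_sums phi r & y = x + s.
Proof.
split=> [/eqP|[s Ss ->]]; last first.
  apply/eqP; rewrite /coset -Quotient.idealrBE opprD addNKr.
  by rewrite rpredN.
rewrite /coset -Quotient.idealrBE => Sxy; exists (y - x); last by rewrite subrKC.
by rewrite -opprB rpredN.
Qed.

Lemma coset_surj (X : quot_space) : exists x, X = coset x.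
Proof.
by exists (repr (X : {ideal_quot (root_sums phi r)})); rewrite /coset reprK.
Qed.

Lemma cosetD : {morph coset : x y / x + y}.
Proof. by move=> x y; rewrite /coset raddfD. Qed.

Definition quot_scale (a : 'F_2) (X : quot_space) : quot_space :=
  coset (a *: repr (X : {ideal_quot (root_sums phi r)})).

Lemma quot_scale_coset a x : quot_scale a (coset x) = coset (a *: x).
Proof.
apply/eqP; rewrite /quot_scale /coset -Quotient.idealrBE -scalerBr rpredZ //.
by rewrite Quotient.idealrBE reprK.
Qed.

Lemma quot_scalerA a b X :
  quot_scale a (quot_scale b X) = quot_scale (a * b) X.
Proof. by have [x ->] := coset_surj X; rewrite !quot_scale_coset scalerA. Qed.

Lemma quot_scale1r : left_id 1 quot_scale.
Proof.
by move=> X; have [x ->] := coset_surj X; rewrite quot_scale_coset scale1r.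
Qed.

Lemma quot_scalerDr : right_distributive quot_scale +%R.
Proof.
move=> a X Y; have [x ->] := coset_surj X; have [y ->] := coset_surj Y.
by rewrite -cosetD !quot_scale_coset scalerDr cosetD.
Qed.

Lemma quot_scalerDl X : {morph quot_scale^~ X : a b / a + b}.
Proof.
move=> a b; have [x ->] := coset_surj X.
by rewrite !quot_scale_coset scalerDl cosetD.
Qed.

HB.instance Definition _ := GRing.Zmodule_isLmodule.Build 'F_2 quot_space
  quot_scalerA quot_scale1r quot_scalerDr quot_scalerDl.

Lemma cosetZ a x : coset (a *: x) = a *: coset x.
Proof. by rewrite -quot_scale_coset. Qed.

End QuotientSpace.

(* Main.v *)
(** Fix for each vertex [v] a walk from [r] to [v] and let [f v] be the coset of
    its sum.  Any two walks from [r] to [v] form together a closed walk at [r],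
    so [f v] does not depend on the choice, and extending a walk along [uv] gives
    [f v = f u + phi* (uv)].  If [f u = f v], then following the walk of [u]
    backwards, a closed walk at [r], and the walk of [v] gives a walk from [u] to
    [v] with sum 0; as distinct atoms are linearly independent, this is a parity
    walk, so [u = v]. *)

From mathcomp Require Import boolp monalg.
Require Import Defs.
From mathcomp Require Import all_boot all_algebra.

Set Implicit Arguments.
Unset Strict Implicit.
Unset Printing Implicit Defensive.

Import GRing.Theory.

Lemma size_undup_map (T S : eqType) (f : T -> S) (s : seq T) :
  size (undup (map f s)) <= size (undup s).
Proof.
rewrite -(size_map f (undup s)); apply: uniq_leq_size (undup_uniq _) _ => y.
by rewrite mem_undup => /mapP[x sx ->]; rewrite map_f ?mem_undup.
Qed.

Section AtomSums.
Local Open Scope ring_scope.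

Lemma binseq_addxx (x : binseq) : x + x = 0.
Proof. by rewrite -{2}[x]binseq_oppr subrr. Qed.

(** An atom that is 1 at [i] must be the indicator of [i], since over ['F_2] all its other
    coordinates can only be 0. *)
Lemma atom_eq (x y : binseq) i :
  atom x -> atom y -> Defs.coord x i = 1 -> Defs.coord y i = 1 -> x = y.
Proof.
have atomE (z : binseq) j : atom z -> Defs.coord z i = 1 ->
    mcoeff j z = (j == i)%:R.
  case=> k _ z1 zi; case: (eqVneq j i) => [->//|/eqP ji].
  case: (F2_cases (mcoeff j z)) => // zj.
  by case: ji; rewrite (z1 _ zi) (z1 _ zj).
by move=> ax ay xi yi; apply/malgP => j; rewrite !atomE.
Qed.

(** At a coordinate [i] where [c] is 1, every other atom of [s] is 0 by [atom_eq], so the vanishing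
    sum read at [i] counts the copies of [c] modulo 2. *)
Lemma odd_count_atoms (s : seq binseq) (c : binseq) :
  {in s, forall x, atom x} -> \sum_(x <- s) x = 0 -> ~~ odd (count_mem c s).
Proof.
move=> atom_s s0; case: (boolP (c \in s)) => [cs|]; last by move/count_memPn->.
have [i ci _] := atom_s c cs.
have : \sum_(x <- s) Defs.coord x i = 0.
  by rewrite -[LHS](raddf_sum (mcoeff i)) s0 raddf0.
rewrite (eq_big_seq (fun x => (x == c)%:R)) => [|x xs]; last first.
  case: eqP => [->//|xc]; case: (F2_cases (Defs.coord x i)) => // xi.
  by case: xc; apply: atom_eq xi ci; apply: atom_s.
rewrite -natr_sum -big_mkcond /= sum1_count => /eqP.
by rewrite -(dvdn_pcharf (pchar_Fp (isT : prime 2))) dvdn2.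
Qed.

End AtomSums.

Section WalkSums.
Local Open Scope ring_scope.
Variables (G : sgraph) (phi : {set G} -> binseq).

Lemma adj_edges (u v : G) : adj u v -> [set u; v] \in edges G.
Proof. by move=> uv; apply/imsetP; exists (u, v); rewrite ?inE. Qed.

Lemma walk_edges_sub (u : G) p : walk u p -> {subset walk_edges u p <= edges G}.
Proof.
elim: p u => //= v p IH u /andP[uv pp] e.
by rewrite inE => /orP[/eqP->|]; [exact: adj_edges | exact: IH].
Qed.

Lemma walk_sum_cons (u v : G) p :
  walk_sum phi u (v :: p) = phi [set u; v] + walk_sum phi v p.
Proof. by rewrite /walk_sum /= big_cons. Qed.

Lemma walk_sum_cat (u : G) p q :
  walk_sum phi u (p ++ q) = walk_sum phi u p + walk_sum phi (last u p) q.
Proof. by rewrite /walk_sum /walk_edges pairmap_cat big_cat. Qed.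

(** Edges are unordered pairs, so reversal keeps their colors, and the sum does not depend on their
    order. *)
Lemma walk_reverse (u : G) p : walk u p ->
  exists q, [/\ walk (last u p) q, last (last u p) q = u
              & walk_sum phi (last u p) q = walk_sum phi u p].
Proof.
elim: p u => [|v p IH] u /=; first by exists [::].
case/andP=> uv /IH[q [wq lq sq]]; exists (rcons q u); split.
- by rewrite /walk rcons_path lq adj_sym uv andbT.
- by rewrite last_rcons.
- rewrite -cats1 walk_sum_cat lq sq !walk_sum_cons [RHS]addrC setUC.
  by rewrite /walk_sum /= big_nil addr0.
Qed.

Lemma walk_sum0_closed (u : G) p : atomic phi -> strong_parity phi ->
  walk u p -> walk_sum phi u p = 0 -> u = last u p.
Proof.
move=> at_phi sp_phi wp p0; apply/eqP/negP => /negP ulp.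
apply: sp_phi; exists u, p; split=> // c; apply: odd_count_atoms => [x|].
  by case/mapP=> e /(walk_edges_sub wp) /at_phi + ->.
by rewrite big_map.
Qed.

Variable r : G.

Lemma walk_sums_edge (u v : G) x : adj u v ->
  x \in walk_sums phi r u -> x + phi [set u; v] \in walk_sums phi r v.
Proof.
move=> uv /asboolP[p [wp lp ->]]; apply/asboolP; exists (rcons p v).
rewrite last_rcons /walk rcons_path lp uv andbT; split=> //.
by rewrite -cats1 walk_sum_cat lp walk_sum_cons /walk_sum /= big_nil addr0.
Qed.

Lemma coset_walk_sums (v : G) x y :
  x \in walk_sums phi r v -> y \in walk_sums phi r v ->
  coset phi r x = coset phi r y.
Proof.
move=> /asboolP[p [wp lp ->]] /asboolP[q [wq lq ->]].
have [q' [wq' lq' sq']] := walk_reverse wq; rewrite lq in wq' lq' sq'.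
(* Following [p] and then [q] backwards gives a closed walk at [r], whose sum is the difference of
   the two sums. *)
apply/coset_eqP; exists (walk_sum phi r (p ++ q')).
  apply/asboolP; exists (p ++ q').
  by split; rewrite /walk ?cat_path ?last_cat ?lp //; apply/andP.
by rewrite walk_sum_cat lp sq' addrA binseq_addxx add0r.
Qed.

Lemma coset_walk_sums_inj (u v : G) x y : atomic phi -> strong_parity phi ->
  x \in walk_sums phi r u -> y \in walk_sums phi r v ->
  coset phi r x = coset phi r y -> u = v.
Proof.
move=> at_phi sp_phi /asboolP[p [wp lp ->]] /asboolP[q [wq lq ->]].
case/coset_eqP=> _ /asboolP[s [ws ls ->]] sqE.
have [p' [wp' lp' sp']] := walk_reverse wp; rewrite lp in wp' lp' sp'.
(* From [u] back to [r], around the closed walk [s], then on to [v]: by [sqE] the sum of [q] cancels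
   the sums of [p'] and [s]. *)
have := @walk_sum0_closed u (p' ++ s ++ q) at_phi sp_phi.
rewrite /walk !cat_path !last_cat lp' ls lq; apply; first exact/and3P.
by rewrite !walk_sum_cat lp' ls sp' sqE addrA binseq_addxx.
Qed.

Lemma walk_sums_nonempty (v : G) :
  connected_graph G -> exists x, x \in walk_sums phi r v.
Proof.
move=> /(_ r v) /connectP[p wp ->]; exists (walk_sum phi r p).
by apply/asboolP; exists p.
Qed.

End WalkSums.

Theorem theorem2p7 (G : sgraph) (r : G) (phi : {set G} -> binseq) :
  connected_graph G -> atomic phi -> strong_parity phi ->
  forall phistar : {set G} -> quot_space phi r,
    (forall u v : G, adj u v ->
       phistar [set u; v] = coset phi r (phi [set u; v])) ->
  [/\ canonical phistar,
      {in edges G, phistar =1 coset phi r \o phi}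
    & num_colors phistar <= num_colors phi].
Proof.
move=> conn at_phi sp_phi phistar phistarE.
have phistar_edges : {in edges G, phistar =1 coset phi r \o phi}.
  by move=> e /imsetP[[u v] + ->]; rewrite inE; apply: phistarE.
split=> //.
- have [w wP] := boolp.choice (fun v => walk_sums_nonempty phi r v conn).
  exists (fun v => coset phi r (w v)) => [u v|u v uv].
    exact: coset_walk_sums_inj.
  rewrite phistarE //.
  (* The walk of [u] extended by the edge also ends at [v], so [w u + phi [set u; v]] may replace
     [w v]; then [w u] cancels. *)
  rewrite -(coset_walk_sums (walk_sums_edge uv (wP u)) (wP v)).
  by rewrite -cosetD addrA binseq_addxx add0r.
- rewrite /num_colors.
  (* The colors of [phistar] are the images of those of [phi] under one map, which cannot create new
     distinct values. *)
  have -> : [seq phistar e | e in edges G] =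
            [seq coset phi r x | x <- [seq phi e | e in edges G]].
    rewrite /image_mem -map_comp; apply/eq_in_map => e.
    by rewrite mem_enum => /phistar_edges.
  exact: size_undup_map.
Qed.
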